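(* Let $G$ be a finite group. For all $h\in G$, $$\sum_{g\in G}P(g,h,g)=\sum_{g\in G}P(g,g,h).$$
   Context: For a finite group $G$ and $g,i,h\in G$, define $$P(g,i,h):=\#\{(j_1,j_2)\in G^2\mid g=j_2\,i\,j_2^{-1}\,j_1\,h\,j_1^{-1}\}.$$ *)

(* Defs.v *)
From mathcomp Require Import all_boot all_fingroup.

Set Implicit Arguments.
Unset Strict Implicit.
Unset Printing Implicit Defensive.

Local Open Scope group_scope.

(* The pair j stands for (j_1, j_2).  Conjugation is written out because
   MathComp's x ^ y is y^-1 * x * y, the opposite of the convention here. *)
Definition P (gT : finGroupType) (G : {group gT}) (g i h : gT) : nat :=
  #|[set j in setX G G | g == j.2 * i * j.2^-1 * j.1 * h * j.1^-1]|.

(* Main.v *)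
Require Import Defs.
From mathcomp Require Import all_boot all_fingroup.

(** The identity holds termwise, because P(g,i,h) is symmetric in i and h: with
    x = j_2 i j_2^-1 and y = j_1 h j_1^-1, rewriting x y as (x y x^-1) x
    exchanges the two conjugacy classes. *)

(** An explicit injection between the two solution sets gives one inequality; exchanging [i] and [h]
    gives the reverse one, so [P_swap] needs no inverse map. *)

Lemma leq_P_swap (gT : finGroupType) (G : {group gT}) (g i h : gT) :
  i \in G -> P G g i h <= P G g h i.
Proof.
move=> iG; rewrite /P.
(* The new second conjugator is [x j_1], which takes [h] to [x y x^-1]; the new first one is [j_2],
   which takes [i] to [x]. *)
pose f (j : gT * gT) := (j.2, j.2 * i * j.2^-1 * j.1)%g.
have f_inj : injective f.
  (* The first component determines [j_2], hence [x], which then cancels on the left. *)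
  by move=> [a b] [c d] [/= -> /mulgI ->].
rewrite -(card_imset _ f_inj); apply: subset_leq_card.
apply/subsetP=> _ /imsetP[[a b]] + ->; rewrite !inE /=.
case/andP=> /andP[aG bG] /eqP ->.
by rewrite bG !groupM ?groupV //= !invMg !invgK !mulgA !mulgKV mulgK.
Qed.

Lemma P_swap (gT : finGroupType) (G : {group gT}) (g i h : gT) :
  i \in G -> h \in G -> P G g i h = P G g h i.
Proof. by move=> iG hG; apply/eqP; rewrite eqn_leq !leq_P_swap. Qed.

Theorem mainTheorem6 (gT : finGroupType) (G : {group gT}) (h : gT)
  (hG : h \in G) :
  \sum_(g in G) P G g h g = \sum_(g in G) P G g g h.
Proof. by apply: eq_bigr => g gG; apply: P_swap. Qed.
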